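(* Let $0<\mu\le L$ and assume that $f-\mu\phi$ and $Lf^*-\phi^*$ are convex. Let $\alpha>0$ and $\beta>0$ satisfy $\alpha\beta=1/L$, and let $z_k=(x_k,y_k)$, $k\ge0$, be generated by $$x_{k+1}-x_k=\alpha\bigl(y_k-x_{k+1}-\beta\nabla\phi^*(\nabla f(x_k))\bigr),$$ $$\nabla\phi(y_{k+1})-\nabla\phi(y_k)=\alpha\bigl(\nabla\phi(x_{k+1})-\nabla\phi(y_{k+1})\bigr)-\frac{\alpha}{\mu}\nabla f(x_{k+1}).$$ Assume the compatibility condition $$\alpha\langle\nabla f(x_{k+1}),y_k-y_{k+1}\rangle\le\frac1L D_{\phi^*}(\nabla f(x_{k+1}),0)+\mu D_\phi(y_{k+1},y_k)$$ holds for the iterates. Then the energy $E(x,y)=D_f(x,x^\star)+\mu D_\phi(x^\star,y)$ satisfies, for all $k\ge 0$, $$E(z_{k+1})\le\frac{1}{1+\alpha}E(z_k).$$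
   Context: $V$ is a finite-dimensional Hilbert space with dual $V^*$ and pairing $\langle\cdot,\cdot\rangle$. $f\in C^1(V)$ is convex of Legendre type, so that $(\nabla f)^{-1}=\nabla f^*$ on the relevant domain, and $x^\star$ is its minimizer ($\nabla f(x^\star)=0$). The mirror function $\phi$ is Legendre: closed, proper, strictly convex, differentiable on $\operatorname{int}\operatorname{dom}\phi$, with $\nabla\phi$ one-to-one from $\operatorname{int}\operatorname{dom}\phi$ onto $\operatorname{int}\operatorname{dom}\phi^*$; thus $(\nabla\phi)^{-1}=\nabla\phi^*$. A star denotes the Fenchel conjugate. It is assumed throughout that $\nabla\phi(0)=0$ and $\nabla\phi^*(0)=0$. All points at which $\nabla\phi$, $\nabla\phi^*$ are evaluated lie in $\operatorname{int}\operatorname{dom}\phi$, $\operatorname{int}\operatorname{dom}\phi^*$ respectively, and $x^\star\in\operatorname{int}\operatorname{dom}\phi$. The Bregman divergence of a differentiable function $h$ is $D_h(u,v)=h(u)-h(v)-\langle\nabla h(v),u-v\rangle$. Convexity of $Lf^*-\phi^*$ (dual relative smoothness) is understood as $D_{\phi^*}(\chi,\eta)\le L D_{f^*}(\chi,\eta)$, equivalently $D_{\phi^*}(\nabla f(x),\nabla f(y))\le L D_f(y,x)$ for all $x,y$. *)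

(* Defs.v *)
From HB Require Import structures.
From mathcomp Require Import all_boot all_order all_algebra.
From mathcomp Require Import all_classical all_reals all_analysis.

Set Implicit Arguments.
Unset Strict Implicit.
Unset Printing Implicit Defensive.

Import Order.TTheory GRing.Theory Num.Theory.
Import numFieldNormedType.Exports.

Local Open Scope classical_set_scope.
Local Open Scope ring_scope.

Section Spaces.
Context {R : realType}.

Definition finite_dimensional (V : lmodType R) : Prop :=
  exists (n : nat) (e : 'I_n -> V),
    forall v : V, exists c : 'I_n -> R, v = \sum_(i < n) c i *: e i.

(* Positivity of the inner product comes from the norm; completeness is
   automatic in finite dimension. *)
Definition hilbert_norm (V : normedModType R) : Prop :=
  exists dot : V -> V -> R,
    [/\ bilinear_for *%R *%R dot,
        forall u v, dot u v = dot v u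
      & forall v, `|v| ^+ 2 = dot v v].

Definition finite_dim_hilbert (V : normedModType R) : Prop :=
  finite_dimensional V /\ hilbert_norm V.

(* [W], with the pairing [pr chi v] = <chi, v>, is the normed dual of [V]:
   chi |-> pr chi is onto the continuous linear functionals, and the norm of
   chi is the operator norm of pr chi (so the map is also injective). *)
Definition is_dual (V W : normedModType R) (pr : W -> V -> R) : Prop :=
  [/\ bilinear_for *%R *%R pr,
      forall l : {linear V -> R^o}, continuous l ->
        exists chi : W, forall v, pr chi v = l v
    & forall chi : W,
        `|chi| = sup [set `|pr chi v| | v in [set v : V | `|v| <= 1]]].

End Spaces.

(* Finite-dimensional spaces are reflexive, so [swap pr] is the pairing that
   makes [V] the dual of [W]; it turns each notion below for functions on [V]
   into the one for functions on the dual [W]. *)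
Definition swap {R V W : Type} (pr : W -> V -> R) : V -> W -> R :=
  fun v chi => pr chi v.

Section Convex.
Context {R : realType} {V : normedModType R}.
Implicit Types h : V -> \bar R.

Definition dom h : set V := [set x | (h x < +oo)%E].

Definition proper h : Prop := (forall x, (-oo < h x)%E) /\ dom h !=set0.

Definition strictly_convex h : Prop :=
  forall (x y : V) (t : R), dom h x -> dom h y -> x != y -> 0 < t < 1 ->
    (h (t *: x + (1 - t) *: y)%R < t%:E * h x + (1 - t)%:E * h y)%E.

End Convex.

Section Legendre.
Context {R : realType} {V W : normedModType R}.
Variable pr : W -> V -> R.
Implicit Types h : V -> \bar R.

Definition fenchel h : W -> \bar R :=
  fun chi => ereal_sup [set ((pr chi v)%:E - h v)%E | v in [set: V]].

(* The element of the dual that represents the Frechet differential; it is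
   meaningful at interior points of [dom h] where [h] is differentiable. *)
Definition grad h (x : V) : W :=
  xget 0 [set chi | forall v, pr chi v = 'd (fine \o h : V -> R^o) x v].

(* Used only for [u] in [dom h] and [v] in its interior, where the values of
   [h] are finite. *)
Definition bregman h (u v : V) : R :=
  fine (h u) - fine (h v) - pr (grad h v) (u - v).

(* For a proper convex function, closed means lower semicontinuous. *)
Definition legendre h : Prop :=
  [/\ proper h,
      lower_semicontinuous h,
      strictly_convex h,
      forall x, (dom h)° x -> differentiable (fine \o h : V -> R^o) x
    & set_bij (dom h)° (dom (fenchel h))° (grad h)].

End Legendre.

Section RelativeSmoothness.
Context {R : realType} {V W : normedModType R}.
Variable pr : W -> V -> R.

(* Convexity of L f^* - phi^*, understood through Bregman divergences:
   D_{phi^*}(chi, eta) <= L D_{f^*}(chi, eta).  The points range over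
   int dom f^*, which is the range of grad f when f is of Legendre type. *)
Definition dual_relatively_smooth (L : R) (f phi : V -> \bar R) : Prop :=
  forall chi eta : W,
    (dom (fenchel pr f))° chi -> (dom (fenchel pr f))° eta ->
    bregman (swap pr) (fenchel pr phi) chi eta
      <= L * bregman (swap pr) (fenchel pr f) chi eta.

Definition energy (mu : R) (f phi : V -> \bar R) (xs x y : V) : R :=
  bregman pr f x xs + mu * bregman pr phi xs y.

End RelativeSmoothness.

(* Main.v *)
Require Import Defs.
From HB Require Import structures.
From mathcomp Require Import all_boot all_order all_algebra.
From mathcomp Require Import all_classical all_reals all_analysis.
From mathcomp Require Import lra.

Import Order.TTheory GRing.Theory Num.Theory.
Import numFieldNormedType.Exports.

Local Open Scope classical_set_scope.
Local Open Scope ring_scope.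

(** Tilting a Legendre function by a small covector moves its maximizer only
    slightly: the margin of strict convexity on a small sphere, which is compact
    in finite dimension, confines the supremum.  Hence the conjugate is
    differentiable with gradient the inverse of [grad h], and dual relative
    smoothness reads D_{phi^*}(g_{k+1}, g_k) <= L D_f(x_k, x_{k+1}), with g_k
    the gradient of f at x_k.  The three-point identity for
    mu (D_phi(xs, y_{k+1}) - D_phi(xs, y_k)) and this bound on
    f(x_{k+1}) - f(x_k) leave exactly the cross term of the compatibility
    condition; the strong convexity of f relative to phi bounds what remains by
    -alpha E(z_{k+1}). *)

(** * Bilinear pairings *)

Section Biscalar.
Context {R : realType} {U V : lmodType R} {B : U -> V -> R}.
Hypothesis hB : bilinear_for *%R *%R B.

Lemma biscalarPl a u u' v : B (a *: u + u') v = a * B u v + B u' v.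
Proof. exact: hB.1. Qed.

Lemma biscalarPr a u v v' : B u (a *: v + v') = a * B u v + B u v'.
Proof. exact: hB.2. Qed.

Lemma biscalar0l v : B 0 v = 0.
Proof.
by have := biscalarPl (-1) 0 0 v; rewrite scaleN1r addNr mulN1r addNr.
Qed.

Lemma biscalar0r u : B u 0 = 0.
Proof.
by have := biscalarPr (-1) u 0 0; rewrite scaleN1r addNr mulN1r addNr.
Qed.

Lemma biscalarZl a u v : B (a *: u) v = a * B u v.
Proof. by have := biscalarPl a u 0 v; rewrite addr0 biscalar0l addr0. Qed.

Lemma biscalarZr a u v : B u (a *: v) = a * B u v.
Proof. by have := biscalarPr a u v 0; rewrite addr0 biscalar0r addr0. Qed.

Lemma biscalarDl u u' v : B (u + u') v = B u v + B u' v.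
Proof. by have := biscalarPl 1 u u' v; rewrite scale1r mul1r. Qed.

Lemma biscalarDr u v v' : B u (v + v') = B u v + B u v'.
Proof. by have := biscalarPr 1 u v v'; rewrite scale1r mul1r. Qed.

Lemma biscalarBl u u' v : B (u - u') v = B u v - B u' v.
Proof. by rewrite biscalarDl -scaleN1r biscalarZl mulN1r. Qed.

Lemma biscalarBr u v v' : B u (v - v') = B u v - B u v'.
Proof. by rewrite biscalarDr -scaleN1r biscalarZr mulN1r. Qed.

Lemma biscalar_suml I (r : seq I) (F : I -> U) v :
  B (\sum_(i <- r) F i) v = \sum_(i <- r) B (F i) v.
Proof.
apply: (big_morph (B^~ v) (fun u u' => biscalarDl u u' v) (biscalar0l v)).
Qed.

Lemma biscalar_sumr I (r : seq I) u (F : I -> V) :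
  B u (\sum_(i <- r) F i) = \sum_(i <- r) B u (F i).
Proof. exact: (big_morph (B u) (biscalarDr u) (biscalar0r u)). Qed.

Lemma biscalar_linearl v : exists l : {linear U -> R^o}, forall u, l u = B u v.
Proof.
have lP : linear (B^~ v : U -> R^o) by move=> a u u'; exact: biscalarPl.
pose l : {linear U -> R^o} :=
  HB.pack (B^~ v : U -> R^o) (GRing.isLinear.Build R U R^o _ (B^~ v) lP).
by exists l.
Qed.

End Biscalar.

Lemma biscalar_swap {R : realType} {U V : lmodType R} {B : U -> V -> R} :
  bilinear_for *%R *%R B -> bilinear_for *%R *%R (swap B).
Proof. by case=> hl hr; split=> u; [exact: hr | exact: hl]. Qed.

Lemma linear_bound_continuous {R : realType} {U : normedModType R}
    (l : {linear U -> R^o}) (C : R) :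
  (forall u, `|l u| <= C * `|u|) -> continuous l.
Proof.
move=> lC u; apply/cvgrPdist_le => e e0.
have C1 : 0 < `|C| + 1 by rewrite ltr_wpDl.
near=> t.
rewrite -linearB; apply: (le_trans (lC _)).
apply: (@le_trans _ _ ((`|C| + 1) * `|u - t|)).
  by apply: ler_wpM2r => //; apply: ler_wpDr => //; exact: ler_norm.
rewrite mulrC -ler_pdivlMr //; near: t.
by apply: cvgr_dist_le; [exact: cvg_id | rewrite divr_gt0].
Unshelve. all: by end_near. Qed.

(** * Orthonormal expansions *)

Section FiniteDimHilbert.
Context {R : realType} {V : normedModType R} {dot : V -> V -> R}.
Hypotheses (dot_bilin : bilinear_for *%R *%R dot)
  (dotC : forall u v, dot u v = dot v u)
  (dot_norm : forall v, `|v| ^+ 2 = dot v v).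

Let dotBl := biscalarBl dot_bilin.
Let dotBr := biscalarBr dot_bilin.
Let dotZl := biscalarZl dot_bilin.
Let dotZr := biscalarZr dot_bilin.

(** Cauchy-Schwarz against a unit vector: the residual [v - dot v q *: q] has squared norm
    [|v|^2 - (dot v q)^2], which is nonnegative. *)
Lemma dot_unit_le v q : dot q q = 1 -> `|dot v q| <= `|v|.
Proof.
move=> q1; rewrite -(ler_pXn2r (n := 2)) ?nnegrE // real_normK ?num_real //.
have : 0 <= dot (v - dot v q *: q) (v - dot v q *: q).
  by rewrite -dot_norm exprn_ge0.
rewrite dotBl !dotBr !dotZl !dotZr q1 (dotC q v) dot_norm.
by nra.
Qed.

(* [q] is an orthonormal basis of the span of [s], possibly padded with zero
   vectors: Gram-Schmidt. *)
Lemma gram_schmidt (s : seq V) : exists q : seq V,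
  [/\ {in q, forall x v, `|dot v x| <= `|v|},
      {in q, forall x, x = \sum_(y <- q) dot x y *: y}
    & {in s, forall x, x = \sum_(y <- q) dot x y *: y}].
Proof.
elim: s => [|e s [q [qle qq sq]]]; first by exists [::]; split.
pose P v := \sum_(y <- q) dot v y *: y.
pose w := e - P e.
(* [P] is the orthogonal projection onto the span of [q]; its symmetry makes the residual [w]
   orthogonal to every vector that [P] fixes. *)
have Psym u v : dot (P u) v = dot u (P v).
  rewrite (biscalar_suml dot_bilin) (biscalar_sumr dot_bilin).
  by apply: eq_bigr => y _; rewrite dotZl dotZr mulrC (dotC y).
have orth x : x = P x -> dot x w = 0.
  by move=> xP; rewrite dotBr -Psym -xP subrr.
have [w0|w0] := eqVneq w 0.
  exists q; split => // x; rewrite inE => /orP[/eqP ->|/sq //].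
  by apply/eqP; rewrite -subr_eq0; apply/eqP.
have nw : `|w| != 0 by rewrite normr_eq0.
pose n := `|w|^-1 *: w.
have n1 : dot n n = 1.
  by rewrite dotZl dotZr -dot_norm expr2 mulKf // mulVf.
have orthn x : x = P x -> dot x n = 0.
  by move=> /orth xw; rewrite dotZr xw mulr0.
have Pn : P n = 0.
  rewrite /P big1_seq // => y /andP[_ yq].
  by rewrite dotC orthn ?scale0r //; exact: qq.
exists (n :: q); split.
- by move=> x; rewrite inE => /orP[/eqP -> v|/qle //]; exact: dot_unit_le.
- move=> x; rewrite inE big_cons => /orP[/eqP ->|/qq xq].
    by rewrite -/(P n) Pn n1 scale1r addr0.
  by rewrite orthn // scale0r add0r.
- move=> x; rewrite inE big_cons => /orP[/eqP ->|/sq xs].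
    rewrite -/(P e) {2}/n scalerA.
    suff -> : dot e n / `|w| = 1 by rewrite scale1r /w subrK.
    have -> : e = w + P e by rewrite /w subrK.
    have PP : P e = P (P e).
      by apply: eq_big_seq => y yq; rewrite Psym /P -(qq _ yq).
    rewrite (biscalarDl dot_bilin) (orthn _ PP) addr0 dotZr -dot_norm.
    by rewrite expr2 mulKf // mulfV.
  by rewrite orthn // scale0r add0r.
Qed.

End FiniteDimHilbert.

(** * Compactness and duality in finite dimension *)

Section FiniteDim.
Context {R : realType} {V : normedModType R}.
Hypothesis hV : finite_dim_hilbert V.

(** The coordinates are the inner products with an orthonormal family. Compactness of spheres and
    boundedness of linear forms are both drawn from this expansion. *)
Lemma bounded_coordinates : exists (q : seq V) (c : V -> V -> R),
  forall v, v = \sum_(x <- q) c v x *: x /\ {in q, forall x, `|c v x| <= `|v|}.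
Proof.
have [[n [e eV]] [dot [dot_bilin dotC dot_norm]]] := hV.
have [q [qle qq eq]] :=
  gram_schmidt dot_bilin dotC dot_norm [seq e i | i <- enum 'I_n].
exists q, dot => v; split; last by move=> x xq; exact: qle.
have [c ->] := eV v.
under [RHS]eq_bigr => x _.
  rewrite (biscalar_suml dot_bilin) scaler_suml.
  under eq_bigr => i _ do rewrite (biscalarZl dot_bilin) -scalerA.
  over.
rewrite exchange_big; apply: eq_bigr => i _ /=.
by rewrite -scaler_sumr -eq // map_f // mem_enum.
Qed.

Lemma sphere_compact (v : V) (r : R) : compact [set u | `|u - v| = r].
Proof.
have [q [c qc]] := bounded_coordinates.
pose S (a : 'rV[R]_(size q)) := \sum_(i < size q) a 0 i *: q`_i.
have cS : continuous S.
  have cSi i : true -> continuous (fun a : 'rV[R]_(size q) => a 0 i *: q`_i).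
    by move=> _ b; apply: (@cvgZr_tmp _ _ _ (nbhs b)); exact: coord_continuous.
  apply: (continuous_big (op := +%R) (x0 := 0 : V) _ cSi).
  exact: add_continuous.
pose T a := v + S a.
have cT : continuous T.
  by move=> a; apply: (cvgD (cvg_cst v) (cS a)).
pose Q := [set a : 'rV[R]_(size q) | forall i, `[- r, r]%classic (a ord0 i)].
have cQ : compact Q.
  apply: (@rV_compact R _ (fun=> `[- r, r]%classic)) => _.
  exact: segment_compact.
(* The sphere is a closed subset of the image of the cube [[-r, r]^n] under the affine map [T]. *)
apply: (@subclosed_compact _ _ (T @` Q)).
- apply: (@closed_comp _ _ (fun u => `|u - v|) [set x | x = r]);
    last exact: closed_eq.
  move=> u _; apply: (@cvg_norm _ _ _ _ _ (fun u => u - v)).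
  by apply: cvgB; [exact: cvg_id | exact: cvg_cst].
- by apply: continuous_compact => //; exact: continuous_subspaceT.
- move=> u /= ur; exists (\row_i c (u - v) q`_i).
    move=> i; rewrite mxE /= in_itv /= -ler_norml -ur.
    by apply: (qc _).2; exact: mem_nth.
  rewrite /T /S; under eq_bigr do rewrite mxE.
  have := (qc (u - v)).1; rewrite (big_nth 0) big_mkord => <-.
  by rewrite addrC subrK.
Qed.

Lemma sphere_margin (h : V -> R) (v : V) (r c : R) :
  (forall u, `|u - v| = r -> {for u, continuous h}) ->
  (forall u, `|u - v| = r -> c < h u) ->
  exists2 m, 0 < m & forall u, `|u - v| = r -> c + m <= h u.
Proof.
move=> hc hgt.
(* The sphere may be empty, for instance when [V] is trivial; any positive margin then works. *)
have [[u0 u0r]|noS] := pselect (exists u, `|u - v| = r); last first.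
  by exists 1 => // u ur; case: noS; exists u.
have [||w wS wmin] := @compact_EVT_min V R h _ _ (sphere_compact v r).
- by exists u0.
- by apply: continuous_in_subspaceT => u; rewrite inE => /hc.
exists (h w - c); first by rewrite subr_gt0 hgt //; move: wS; rewrite inE.
by move=> u ur; rewrite addrC subrK wmin // inE.
Qed.

Lemma linear_bounded (l : {linear V -> R^o}) :
  exists C, forall v, `|l v| <= C * `|v|.
Proof.
have [q [c qc]] := bounded_coordinates.
exists (\sum_(x <- q) `|l x|) => v.
rewrite {1}(qc v).1 linear_sum /= mulr_suml.
apply: le_trans (ler_norm_sum _ _ _) _.
rewrite big_seq [leRHS]big_seq; apply: ler_sum => x xq.
rewrite linearZ /= normrZ mulrC ler_wpM2l //.
exact: (qc v).2.
Qed.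

Section Dual.
Context {W : normedModType R} {pr : W -> V -> R}.
Hypothesis hW : is_dual pr.

Lemma dual_bilin : bilinear_for *%R *%R pr.
Proof. by case: hW. Qed.

Lemma dual_norm_ge chi v : `|pr chi v| <= `|chi| * `|v|.
Proof.
have [hB _ hN] := hW.
have [->|v0] := eqVneq v 0; first by rewrite (biscalar0r hB) !normr0 mulr0.
have nv : 0 < `|v| by rewrite normr_gt0.
have [l lE] := biscalar_linearl (biscalar_swap hB) chi.
(* The norm of [chi] is a [sup], which dominates its set only if that set is bounded above; finite
   dimension provides the bound. *)
have [C hC] : exists C, forall u, `|pr chi u| <= C * `|u|.
  by have [C hC] := linear_bounded l; exists C => u; have := hC u; rewrite lE.
rewrite -ler_pdivrMr // hN; apply: ub_le_sup.
  exists `|C| => _ [w /= w1 <-]; apply: le_trans (hC w) _.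
  apply: (@le_trans _ _ (`|C| * `|w|)); first by rewrite ler_wpM2r // ler_norm.
  by rewrite -[leRHS]mulr1 ler_wpM2l.
exists (`|v|^-1 *: v).
  by rewrite /= normrZ normfV normr_id mulVf // gt_eqF.
by rewrite (biscalarZr hB) normrM normfV normr_id mulrC.
Qed.

(** The differential is a continuous linear form, hence is represented by a covector, so [xget] does
    not fall back on its default 0. *)
Lemma dual_grad (h : V -> \bar R) (x : V) :
  differentiable (fine \o h : V -> R^o) x ->
  forall v, pr (grad pr h x) v = 'd (fine \o h : V -> R^o) x v.
Proof.
move=> hd; rewrite /grad; case: xgetP => // noW.
have [_ + _] := hW => /(_ ('d (fine \o h : V -> R^o) x)) [|chi chiP].
  exact: diff_continuous.
by case: (noW chi).
Qed.

End Dual.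
End FiniteDim.

(** * First-order inequality for convex functions *)

Section GradientInequality.
Context {R : realType} {V : normedModType R}.

Lemma diff_remainder {h : V -> R} {v : V} : differentiable (h : V -> R^o) v ->
  forall e, 0 < e ->
  \forall k \near (0 : V),
    `|h (k + v) - h v - 'd (h : V -> R^o) v k| <= e * `|k|.
Proof.
move=> /diff_locally /eqaddoP hd e e0; have := hd _ e0.
apply: filterS => k /=.
by rewrite !fctE opprD addrA.
Qed.

Lemma gradient_ineq {h : V -> R} {u v : V} : differentiable (h : V -> R^o) v ->
  (forall t, 0 < t < 1 ->
    h (t *: u + (1 - t) *: v) <= t * h u + (1 - t) * h v) ->
  'd (h : V -> R^o) v (u - v) <= h u - h v.
Proof.
move=> hd hc; set w := u - v.
apply/ler_addgt0Pr => e e0.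
have e1 : 0 < e / (`|w| + 1) by rewrite divr_gt0 // ltr_wpDl.
have /nbhs_ballP[d /= d0 hdk] := diff_remainder hd _ e1.
(* Convexity needs [t < 1] and the remainder estimate needs [t * |w| < d]; the [+ 1] keeps the
   denominator positive when [w = 0]. *)
pose t := Num.min (1 / 2) (d / 2 / (`|w| + 1)).
have w1 : 0 < `|w| + 1 by rewrite ltr_wpDl.
have t0 : 0 < t by rewrite lt_min !divr_gt0.
have t1 : t < 1 by rewrite gt_min; apply/orP; left; lra.
have tw : `|t *: w| < d.
  rewrite normrZ gtr0_norm //.
  apply: (@le_lt_trans _ _ (d / 2 / (`|w| + 1) * (`|w| + 1))); last first.
    by rewrite divfK ?gt_eqF //; lra.
  by apply: ler_pM; rewrite ?(ltW t0) // ?lerDl // /t ge_min lexx orbT.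
have := hdk (t *: w); rewrite -ball_normE /= sub0r normrN => /(_ tw).
rewrite linearZ /= normrZ gtr0_norm // => /ler_normlP[+ _].
have -> : t *: w + v = t *: u + (1 - t) *: v.
  by rewrite /w scalerBr scalerBl scale1r addrAC addrA.
have := hc t; rewrite t0 t1 => /(_ isT) hct.
have ew : e / (`|w| + 1) * (t * `|w|) <= t * e.
  rewrite mulrCA ler_wpM2l ?(ltW t0) // mulrAC ler_pdivrMr //.
  rewrite ler_wpM2l ?(ltW e0) //.
  by rewrite lerDl.
set D := 'd _ _ _ => hr.
have : t * D <= t * (h u - h v + e).
  by have tE : t *: (D : R^o) = t * D by []; rewrite tE in hr; nra.
by rewrite ler_pM2l.
Qed.

End GradientInequality.

(** * Conjugates of Legendre functions *)

Section Legendre.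
Context {R : realType} {V W : normedModType R} {pr : W -> V -> R}.
Hypotheses (hV : finite_dim_hilbert V) (hW : is_dual pr).
Context {h : V -> \bar R}.
Hypothesis hL : legendre pr h.

Let prB := dual_bilin hW.

Lemma legendre_fineK u : dom h u -> (fine (h u))%:E = h u.
Proof.
have [[hNy _] _ _ _ _] := hL => hu; rewrite fineK // fin_numE.
by rewrite gt_eqF //= lt_eqF.
Qed.

Lemma legendre_convex u v t : dom h u -> dom h v -> u != v -> 0 < t < 1 ->
  dom h (t *: u + (1 - t) *: v) /\
  fine (h (t *: u + (1 - t) *: v)) < t * fine (h u) + (1 - t) * fine (h v).
Proof.
have [_ _ hC _ _] := hL => hu hv uv t01.
have := hC _ _ _ hu hv uv t01.
rewrite -{1}(legendre_fineK _ hu) -{1}(legendre_fineK _ hv).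
rewrite -!EFinM -EFinD => hlt.
have hz : dom h (t *: u + (1 - t) *: v).
  by rewrite /dom /=; apply: lt_trans hlt _; exact: ltry.
by split => //; rewrite -lte_fin legendre_fineK.
Qed.

Lemma legendre_convexW u v t : dom h u -> dom h v -> 0 < t < 1 ->
  fine (h (t *: u + (1 - t) *: v)) <= t * fine (h u) + (1 - t) * fine (h v).
Proof.
move=> hu hv t01; have [<-|uv] := eqVneq u v.
  by rewrite -scalerDl -mulrDl addrC subrK scale1r mul1r.
by have [_ /ltW] := legendre_convex _ _ _ hu hv uv t01.
Qed.

Lemma legendre_grad v : (dom h)° v ->
  forall w, pr (grad pr h v) w = 'd (fine \o h : V -> R^o) v w.
Proof. by have [_ _ _ hd _] := hL => /hd; exact: dual_grad. Qed.

Lemma legendre_gradient_ineq u v : dom h u -> (dom h)° v ->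
  pr (grad pr h v) (u - v) <= fine (h u) - fine (h v).
Proof.
move=> hu hv; rewrite legendre_grad //.
have [_ _ _ hd _] := hL.
apply: gradient_ineq; first exact: hd.
by move=> t; apply: legendre_convexW => //; exact: interior_subset.
Qed.

(** At the midpoint [h] lies strictly below the chord, so the weak inequality applied there becomes
    strict at [u]. *)
Lemma legendre_gradient_lt u v : dom h u -> (dom h)° v -> u != v ->
  pr (grad pr h v) (u - v) < fine (h u) - fine (h v).
Proof.
move=> hu hv uv; have hv' := interior_subset hv.
have h01 : ((0 : R) < 1 / 2) && (1 / 2 < (1 : R)).
  by apply/andP; split; lra.
pose w := (1 / 2) *: u + (1 - 1 / 2) *: v.
have [dw hw] := legendre_convex _ _ _ hu hv' uv h01.
have wv : w - v = (1 / 2) *: (u - v).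
  by rewrite /w scalerBl scale1r scalerBr addrA addrAC addrK.
have := legendre_gradient_ineq _ _ dw hv.
rewrite wv (biscalarZr prB).
by rewrite -/w in dw hw *; lra.
Qed.

Lemma fenchel_ge chi u : dom h u ->
  ((pr chi u - fine (h u))%:E <= fenchel pr h chi)%E.
Proof.
by move=> hu; apply: ereal_sup_ubound; exists u => //; rewrite -legendre_fineK.
Qed.

Lemma fenchel_le chi M : (forall u, dom h u -> pr chi u - fine (h u) <= M) ->
  (fenchel pr h chi <= M%:E)%E.
Proof.
move=> hM; apply: ge_ereal_sup => _ [u _ <-].
have [hu|] := pselect (dom h u).
  by rewrite -legendre_fineK // -EFinB lee_fin hM.
rewrite /dom /= ltey => /negP; rewrite negbK => /eqP ->.
by rewrite leNye.
Qed.

Lemma fenchel_fineK chi : dom (fenchel pr h) chi ->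
  (fine (fenchel pr h chi))%:E = fenchel pr h chi.
Proof.
move=> hchi; rewrite fineK // fin_numE; apply/andP; split; last first.
  by rewrite lt_eqF.
have [[_ [u hu]] _ _ _ _] := hL.
by rewrite gt_eqF // (lt_le_trans _ (fenchel_ge chi _ hu)) // ltNyr.
Qed.

(** Equality case of Fenchel-Young: by the gradient inequality, [v] attains the supremum that
    defines the conjugate. *)
Lemma fenchel_grad v : (dom h)° v ->
  fenchel pr h (grad pr h v) = (pr (grad pr h v) v - fine (h v))%:E.
Proof.
move=> hv; apply/eqP; rewrite eq_le; apply/andP; split.
  apply: fenchel_le => u hu.
  by have := legendre_gradient_ineq _ _ hu hv; rewrite (biscalarBr prB); lra.
by apply: fenchel_ge; exact: interior_subset.
Qed.

(* The maximizer [v] of <grad h v, .> - h is isolated by strict convexity, so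
   tilting by a small [delta] moves the supremum only inside a ball of radius
   [e] around [v]; this bounds the increment of the conjugate. *)
Lemma tilted_max v e : (dom h)° v -> 0 < e ->
  exists2 d, 0 < d & forall delta, `|delta| <= d -> forall u, dom h u ->
    pr (grad pr h v + delta) u - fine (h u)
      <= pr (grad pr h v + delta) v - fine (h v) + e * `|delta|.
Proof.
move=> hv e0; have [_ _ _ hd _] := hL.
have : nbhs v (dom h)°.
  by apply: open_nbhs_nbhs; split => //; exact: open_interior.
move=> /nbhs_ballP[d0 /= d00 hball].
set g := grad pr h v.
(* [r <= e] settles the points inside the ball, and [r < d0] keeps the sphere in the interior of the
   domain, where [k] is continuous. *)
pose r := Num.min e (d0 / 2).
have r0 : 0 < r by rewrite lt_min e0 divr_gt0.
have re : r <= e by rewrite ge_min lexx.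
have rd : r < d0 by rewrite gt_min; apply/orP; right; lra.
pose k u := fine (h u) - pr g u.
have [l lE] := biscalar_linearl (biscalar_swap prB) g.
have cl : continuous l.
  apply: (linear_bound_continuous l `|g|) => u.
  by rewrite lE /swap; exact: (dual_norm_ge hV hW).
have kc u : `|u - v| = r -> {for u, continuous k}.
  move=> ur; have hu : (dom h)° u.
    by apply: hball; rewrite -ball_normE /= distrC ur.
  have -> : k = (fine \o h) \- (l : V -> R).
    by apply/funext => w; rewrite /k /= lE.
  apply: (@continuousB R R^o V (fine \o h) l); last exact: cl.
  exact/differentiable_continuous/hd.
have kv u : dom h u -> k v <= k u.
  move=> hu; have := legendre_gradient_ineq _ _ hu hv.
  by rewrite -/g (biscalarBr prB) /k; lra.
have kgt u : `|u - v| = r -> k v < k u.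
  move=> ur; have hu : (dom h)° u.
    by apply: hball; rewrite -ball_normE /= distrC ur.
  have uv : u != v by rewrite -subr_eq0 -normr_eq0 ur gt_eqF.
  have := legendre_gradient_lt _ _ (interior_subset hu) hv uv.
  by rewrite -/g (biscalarBr prB) /k; lra.
have [m m0 km] := sphere_margin hV _ _ _ _ kc kgt.
(* By convexity, the excess [k u - k v] is at least [m / r * |u - v|] outside the ball, which beats
   any tilt of norm at most [m / r]. *)
exists (m / r); first exact: divr_gt0.
move=> delta dm u hu.
rewrite !(biscalarDl prB).
suff : pr delta (u - v) <= k u - k v + e * `|delta|.
  by rewrite (biscalarBr prB) /k; lra.
have dle : pr delta (u - v) <= `|delta| * `|u - v|.
  exact: le_trans (ler_norm _) (dual_norm_ge hV hW _ _).
apply: (le_trans dle).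
have [ur|ur] := leP `|u - v| r.
  apply: ler_wpDl; first by rewrite subr_ge0 kv.
  by rewrite mulrC ler_wpM2r // (le_trans ur).
apply: ler_wpDr; first by rewrite mulr_ge0 // ltW.
have n0 : 0 < `|u - v| := lt_trans r0 ur.
(* This [t] moves [u] along the segment towards [v] onto the sphere, where the margin [m] holds. *)
pose t := r / `|u - v|.
have t0 : 0 < t by rewrite divr_gt0.
have t1 : t < 1 by rewrite ltr_pdivrMr // mul1r.
have t01 : 0 < t < 1 by rewrite t0.
have := km (t *: u + (1 - t) *: v).
have -> : t *: u + (1 - t) *: v - v = t *: (u - v).
  by rewrite scalerBl scale1r scalerBr addrA addrAC addrK.
rewrite normrZ gtr0_norm // divfK ?gt_eqF // => /(_ erefl).
have := legendre_convexW _ _ _ hu (interior_subset hv) t01.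
rewrite {2 3}/k (biscalarDr prB) !(biscalarZr prB) => h1 h2.
have mt : m <= t * (k u - k v) by rewrite /k in h2 *; lra.
apply: (@le_trans _ _ (m / r * `|u - v|)); first by rewrite ler_wpM2r.
have -> : m / r * `|u - v| = m / t by rewrite /t invf_div mulrA mulrAC.
by rewrite ler_pdivrMr // mulrC.
Qed.

(** The first-order remainder of the conjugate at [grad pr h v] is squeezed: it is at least 0 by
    testing the supremum at [v], and at most [e * |delta|] by [tilted_max]. *)
Lemma fenchel_diff v : (dom h)° v -> forall chi,
  'd (fine \o fenchel pr h : W -> R^o) (grad pr h v) chi = pr chi v.
Proof.
move=> hv chi; set g := grad pr h v.
have [l lE] := biscalar_linearl prB v.
rewrite -lE; apply: (congr1 (fun F : W -> R^o => F chi)).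
apply: diff_unique.
  apply: (linear_bound_continuous l `|v|) => u.
  by rewrite lE mulrC; exact: (dual_norm_ge hV hW).
apply/eqaddoP => e e0.
have [d d0 hd] := tilted_max _ _ hv e0.
apply/nbhs_ballP; exists d => //= delta.
rewrite -ball_normE /= sub0r normrN => /ltW deltad.
rewrite !fctE /= lE.
have le := fenchel_le _ _ (hd _ deltad).
have ge := fenchel_ge (g + delta) _ (interior_subset hv).
have fin : dom (fenchel pr h) (g + delta) by exact: le_lt_trans le (ltry _).
rewrite -/g -(fenchel_fineK _ fin) in le ge.
rewrite !lee_fin (biscalarDl prB) in le ge.
rewrite [in delta + g]addrC fenchel_grad // -/g /= ler_norml.
by apply/andP; split; lra.
Qed.

Lemma grad_fenchel v : (dom h)° v -> forall chi,
  pr chi (grad (swap pr) (fenchel pr h) (grad pr h v)) = pr chi v.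
Proof.
move=> hv chi; rewrite [grad (swap pr) _ _]/grad.
case: xgetP => [w _ wP|noV].
  by rewrite -(fenchel_diff _ hv) -wP.
(* [v] itself represents the differential, so the default value of [xget] is excluded. *)
by case: (noV v) => chi'; rewrite fenchel_diff.
Qed.

End Legendre.

(** * Bregman divergences and conjugation *)

Section Bregman.
Context {R : realType} {V W : normedModType R} {pr : W -> V -> R}.
Hypotheses (hV : finite_dim_hilbert V) (hW : is_dual pr).

Let prB := dual_bilin hW.

Lemma bregman_ge0 (h : V -> \bar R) (u v : V) : legendre pr h ->
  dom h u -> (dom h)° v -> 0 <= bregman pr h u v.
Proof.
by move=> hL hu hv; rewrite subr_ge0; exact: legendre_gradient_ineq.
Qed.

(** Fenchel-Young equality at both points, together with the gradient of the conjugate inverting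
    [grad pr h], exchanges the two arguments. *)
Lemma bregman_fenchel (h : V -> \bar R) (u v : V) : legendre pr h ->
  (dom h)° u -> (dom h)° v ->
  bregman (swap pr) (fenchel pr h) (grad pr h u) (grad pr h v)
    = bregman pr h v u.
Proof.
move=> hL hu hv; rewrite /bregman /swap (grad_fenchel hV hW hL _ hv).
rewrite !(fenchel_grad hW hL) //=.
move: (grad pr h u) (grad pr h v) => gu gv.
by rewrite (biscalarBl prB) (biscalarBr prB); lra.
Qed.

(* [fenchel_grad] turns the left-hand side into h^*(0) + h(v). *)
Lemma fenchel_bregman0_ge0 (h : V -> \bar R) (v : V) : legendre pr h ->
  (dom h)° v -> dom (fenchel pr h) 0 ->
  0 <= bregman (swap pr) (fenchel pr h) 0 (grad pr h v).
Proof.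
move=> hL hv h0; rewrite /bregman /swap (grad_fenchel hV hW hL _ hv).
rewrite (fenchel_grad hW hL) //=.
have := fenchel_ge hL 0 _ (interior_subset hv).
rewrite -(fenchel_fineK hL _ h0) lee_fin (biscalar0l prB).
move: (grad pr h v) => g.
by rewrite (biscalarBl prB) (biscalar0l prB); lra.
Qed.

(** This is the gradient inequality for the convex function [H = f - mu * phi], with its
    differential split by linearity. *)
Lemma relative_strong_convexity (f : V -> R) (phi : V -> \bar R) (mu : R)
    (u v : V) :
  differentiable (f : V -> R^o) v -> legendre pr phi ->
  @convex_function R V (dom phi) (fun x => f x - mu * fine (phi x)) ->
  dom phi u -> (dom phi)° v ->
  mu * bregman pr phi u v <= bregman pr (EFin \o f) u v.
Proof.
move=> fd hL fc hu hv; pose H w := f w - mu * fine (phi w).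
have [_ _ _ phid _] := hL.
have dmu := differentiableZ mu (phid _ hv).
have dH : differentiable (H : V -> R^o) v := differentiableB fd dmu.
have cH t : 0 < t < 1 -> H (t *: u + (1 - t) *: v) <= t * H u + (1 - t) * H v.
  move=> /andP[t0 t1].
  have t01 : Itv.spec (@Itv.num_sem R) (Itv.Real `[0%Z, 1%Z]) t.
    by rewrite /= /Itv.num_sem /= num_real in_itv /= !ltW.
  have := fc (Itv.mk t01) u v.
  by apply; rewrite inE //; exact: interior_subset.
have dHE : 'd (H : V -> R^o) v (u - v)
    = pr (grad pr (EFin \o f) v) (u - v) - mu * pr (grad pr phi v) (u - v).
  have ef := dual_grad hW (EFin \o f) v fd (u - v).
  have ephi := legendre_grad hW hL v hv (u - v).
  apply: (etrans _ (esym (congr2 (fun a b => a - mu * b) ef ephi))).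
  apply: (etrans (congr1 (fun D => D (u - v)) (diffB fd dmu))).
  exact: (congr1 (fun D => 'd (f : V -> R^o) v (u - v) - D (u - v))
    (diffZ mu (phid _ hv))).
have lin (a b : R) : a - mu * b <= H u - H v ->
    mu * (fine (phi u) - fine (phi v) - b) <= f u - f v - a.
  by rewrite /H; lra.
apply: lin; rewrite -dHE.
exact: gradient_ineq dH cH.
Qed.

End Bregman.

(** * Energy decay along the scheme *)

(* One step of the scheme with abstract covectors: [g], [g'] stand for the
   gradients of f at x_k, x_(k+1), [a] for that of phi at x_(k+1), [b], [b'] for
   those of phi at y_k, y_(k+1), and [A], [B], [C] for the values of phi^* at
   [g'], [g], 0. *)
Lemma energy_step {R : realType} {V W : lmodType R} {pr : W -> V -> R}
    (prB : bilinear_for *%R *%R pr) (mu L alpha beta : R)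
    (x x' y y' xs p : V) (g g' a b b' : W)
    (fx fx' fxs phixs phix phiy phiy' A B C : R) :
  0 < mu -> 0 < L -> 0 < alpha -> alpha * beta = 1 / L ->
  x' - x = alpha *: (y - x' - beta *: p) ->
  b' - b = alpha *: (a - b') - (alpha / mu) *: g' ->
  alpha * pr g' (y - y')
    <= 1 / L * (A - C) + mu * (phiy' - phiy - pr b (y' - y)) ->
  A - B - pr (g' - g) p <= L * (fx - fx' - pr g' (x - x')) ->
  0 <= C - B - pr (0 - g) p ->
  0 <= phiy' - phix - pr a (y' - x') ->
  mu * (phixs - phix - pr a (xs - x')) <= fxs - fx' - pr g' (xs - x') ->
  fx' - fxs + mu * (phixs - phiy' - pr b' (xs - y'))
    <= 1 / (1 + alpha) * (fx - fxs + mu * (phixs - phiy - pr b (xs - y))).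
Proof.
move=> mu0 L0 alpha0 ab xE yE compat dual_le conj_ge phi_ge strong.
rewrite mul1r [leRHS]mulrC ler_pdivlMr; last by rewrite addr_gt0.
have xE' : pr g' (x' - x)
    = alpha * pr g' (y - x') - 1 / L * pr g' p.
  rewrite xE (biscalarZr prB) (biscalarBr prB) (biscalarZr prB).
  by rewrite mulrBr mulrA ab.
(* By the three-point identity, the pairing of [a - b'] with [y' - xs] is D_phi(xs, x') - D_phi(xs,
   y') - D_phi(y', x'). The first term is absorbed by [strong], the second gives the decay, and the
   third has a sign by [phi_ge]. *)
have yE' : mu * pr (b' - b) (y' - xs)
    = alpha * (mu * pr (a - b') (y' - xs)) - alpha * pr g' (y' - xs).
  rewrite yE (biscalarBl prB) !(biscalarZl prB) mulrBr; congr (_ - _).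
    by rewrite mulrCA.
  by rewrite mulrA (mulrC mu) divfK ?gt_eqF.
(* Subtracting D_{phi^*}(0, g) from D_{phi^*}(g', g) cancels [B] and the pairing of [g] with [p].
   The remaining pairing of [g'] with [p] matches the one in [xE']. *)
have fE : A - C - pr g' p <= L * (fx - fx' - pr g' (x - x')).
  apply: le_trans dual_le.
  by move: conj_ge; rewrite !(biscalarBl prB) (biscalar0l prB); lra.
have {fE} : 1 / L * (A - C - pr g' p) <= fx - fx' - pr g' (x - x').
  by rewrite mulrC mul1r ler_pdivrMr // mulrC.
have {phi_ge} : 0 <= alpha * mu * (phiy' - phix - pr a (y' - x')).
  by rewrite mulr_ge0 // mulr_ge0 // ltW.
have {strong} := ler_wpM2l (ltW alpha0) strong.
move: xE' yE' compat; rewrite !(biscalarBl prB) !(biscalarBr prB).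
move: (1 / L) (pr g' p) (pr g' x) (pr g' x') (pr g' xs) (pr g' y) (pr g' y').
move: (pr a xs) (pr a x') (pr a y') (pr b xs) (pr b y) (pr b y').
move: (pr b' xs) (pr b' y') => *; lra.
Qed.

Theorem theoremB2 (R : realType) (V W : normedModType R) (pr : W -> V -> R)
  (hV : finite_dim_hilbert V) (hW : is_dual pr)
  (f : V -> R) (phi : V -> \bar R) (xs : V)
  (f_diff : forall x, differentiable (f : V -> R^o) x)
  (f_C1 : continuous (grad pr (EFin \o f)))
  (f_legendre : legendre pr (EFin \o f))
  (xs_min : forall x, f xs <= f x)
  (xs_crit : grad pr (EFin \o f) xs = 0)
  (phi_legendre : legendre pr phi)
  (dom_0 : (dom phi)° 0)
  (grad_0 : grad pr phi 0 = 0)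
  (doms_0 : (dom (fenchel pr phi))° 0)
  (grads_0 : grad (swap pr) (fenchel pr phi) 0 = 0)
  (dom_xs : (dom phi)° xs)
  (doms_gradf : forall x, (dom (fenchel pr phi))° (grad pr (EFin \o f) x))
  (mu L alpha beta : R)
  (mu_gt0 : 0 < mu) (mu_le_L : mu <= L)
  (f_phi_convex :
    @convex_function R V (dom phi) (fun x => f x - mu * fine (phi x)))
  (fs_phis_convex : dual_relatively_smooth pr L (EFin \o f) phi)
  (alpha_gt0 : 0 < alpha) (beta_gt0 : 0 < beta)
  (alpha_beta : alpha * beta = 1 / L)
  (x y : nat -> V)
  (dom_x : forall k, (dom phi)° (x k.+1))
  (dom_y : forall k, (dom phi)° (y k))
  (x_step : forall k,
    x k.+1 - x k =
      alpha *: (y k - x k.+1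
        - beta *: grad (swap pr) (fenchel pr phi)
                    (grad pr (EFin \o f) (x k))))
  (y_step : forall k,
    grad pr phi (y k.+1) - grad pr phi (y k) =
      alpha *: (grad pr phi (x k.+1) - grad pr phi (y k.+1))
      - (alpha / mu) *: grad pr (EFin \o f) (x k.+1))
  (compat : forall k,
    alpha * pr (grad pr (EFin \o f) (x k.+1)) (y k - y k.+1)
      <= 1 / L * bregman (swap pr) (fenchel pr phi)
                   (grad pr (EFin \o f) (x k.+1)) 0
         + mu * bregman pr phi (y k.+1) (y k)) :
  forall k : nat,
    energy pr mu (EFin \o f) phi xs (x k.+1) (y k.+1)
      <= 1 / (1 + alpha) * energy pr mu (EFin \o f) phi xs (x k) (y k).
Proof.
have prB := dual_bilin hW.
have L_gt0 : 0 < L := lt_le_trans mu_gt0 mu_le_L.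
have domf u : (dom (EFin \o f))° u.
  have -> : dom (EFin \o f) = setT.
    by apply/seteqP; split => // w _; exact: ltry.
  by rewrite interiorT.
have [_ _ _ _ [gradf_dom _ _]] := f_legendre.
have [_ _ _ _ [_ _ phi_surj]] := phi_legendre.
have bregman_xs u : bregman pr (EFin \o f) u xs = f u - f xs.
  by rewrite /bregman xs_crit (biscalar0l prB) subr0.
move=> k; rewrite /energy !bregman_xs.
have smooth := fs_phis_convex _ _ (gradf_dom _ (domf (x k.+1)))
  (gradf_dom _ (domf (x k))).
rewrite (bregman_fenchel hV hW _ _ _ f_legendre (domf _) (domf _)) in smooth.
have conj_ge0 : 0 <= bregman (swap pr) (fenchel pr phi) 0
    (grad pr (EFin \o f) (x k)).
  (* The gradient of f at x_k lies in the range of [grad pr phi], so nonnegativity can be read off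
     at a preimage [v]. *)
  have [v phiv <-] := phi_surj _ (doms_gradf (x k)).
  exact: fenchel_bregman0_ge0 hV hW _ _ phi_legendre phiv
    (interior_subset doms_0).
have compat_k := compat k.
(* Since the gradient of phi^* vanishes at 0, the divergence in the compatibility condition is the
   plain difference [A - C] of [energy_step]. *)
have conj0 chi : bregman (swap pr) (fenchel pr phi) chi 0
    = fine (fenchel pr phi chi) - fine (fenchel pr phi 0).
  by rewrite /bregman grads_0 /swap (biscalar0r prB) subr0.
rewrite conj0 in compat_k.
have phi_ge0 := bregman_ge0 hW _ _ _ phi_legendre
  (interior_subset (dom_y k.+1)) (dom_x k).
have strong := relative_strong_convexity hW _ _ _ _ _ (f_diff _) phi_legendre
  f_phi_convex (interior_subset dom_xs) (dom_x k).
exact: (energy_step prB _ _ _ _ _ _ _ _ _ _ _ _ _ _ _ _ _ _ _ _ _ _ _ _ _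
  mu_gt0 L_gt0 alpha_gt0 alpha_beta (x_step k) (y_step k)
  compat_k smooth conj_ge0 phi_ge0 strong).
Qed.
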